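(* For every $\mathbf{q}=[x\ y\ \theta\ \varphi\ \delta_f\ \delta_r]^{\mathrm T}\in\mathbb{R}^6$, the reduced inertia matrix $\tilde{\mathbf{M}}(\mathbf{q})$ is symmetric and positive definite.
   Context: Parameters $m,I,I_\varphi,I_\delta,r,a,b>0$ and $A=\frac{a}{2(a^2+b^2)}$. The reduced inertia matrix is $\tilde{\mathbf{M}}(\mathbf{q})=\mathbf{J}^{\mathrm T}(\mathbf{q})\,\mathrm{diag}(m,m,I,4I_\varphi,2I_\delta,2I_\delta)\,\mathbf{J}(\mathbf{q})$, where $\mathbf{J}(\mathbf{q})\in\mathbb{R}^{6\times3}$ has first column $$\big[\tfrac12(\cos(\delta_f+\theta)+\cos(\delta_r+\theta)),\ \tfrac12(\sin(\delta_f+\theta)+\sin(\delta_r+\theta)),\ A(\sin\delta_f-\sin\delta_r),\ r^{-1},\ 0,\ 0\big]^{\mathrm T}$$ and second and third columns the standard basis vectors $e_5,e_6$ of $\mathbb{R}^6$. Explicitly, $\tilde{\mathbf{M}}(\mathbf{q})=\mathrm{diag}(\tilde M_{11},2I_\delta,2I_\delta)$ with $\tilde M_{11}=\frac{4I_\varphi}{r^2}+\frac m2(1+\cos(\delta_f-\delta_r))+IA^2(\sin\delta_f-\sin\delta_r)^2$. *)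

(* Defs.v *)
From HB Require Import structures.
From mathcomp Require Import all_boot all_order all_algebra.
From mathcomp Require Import reals trigo.
Set Implicit Arguments.
Unset Strict Implicit.
Unset Printing Implicit Defensive.
Import Order.TTheory GRing.Theory Num.Theory.
Local Open Scope ring_scope.

(* Configuration q = [x y theta phi delta_f delta_r]^T. Numerals of type 'I_6
   are 0-based indices. *)
Definition theta (R : realType) (q : 'cV[R]_6) : R := q 2 0.
Definition delta_f (R : realType) (q : 'cV[R]_6) : R := q 4 0.
Definition delta_r (R : realType) (q : 'cV[R]_6) : R := q 5 0.

Definition geomA (R : realType) (a b : R) : R := a / (2 * (a ^+ 2 + b ^+ 2)).

Definition jacobian_col1 (R : realType) (r a b : R) (q : 'cV[R]_6) : 'cV[R]_6 :=
  \col_(i < 6)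
    [:: (cos (delta_f q + theta q) + cos (delta_r q + theta q)) / 2;
        (sin (delta_f q + theta q) + sin (delta_r q + theta q)) / 2;
        geomA a b * (sin (delta_f q) - sin (delta_r q));
        r^-1; 0; 0]`_i.

(* The last two columns are e_5 and e_6 in 1-based numbering. *)
Definition jacobian (R : realType) (r a b : R) (q : 'cV[R]_6) : 'M[R]_(6, 3) :=
  row_mx (jacobian_col1 r a b q)
    (row_mx (delta_mx 4 0 : 'cV[R]_6) (delta_mx 5 0 : 'cV[R]_6)).

Definition inertia_diag (R : realType) (m Iz Iphi Idelta : R) : 'M[R]_6 :=
  diag_mx (\row_(i < 6)
    [:: m; m; Iz; 4 * Iphi; 2 * Idelta; 2 * Idelta]`_i).

Definition reduced_inertia (R : realType) (m Iz Iphi Idelta r a b : R)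
    (q : 'cV[R]_6) : 'M[R]_3 :=
  (jacobian r a b q)^T *m inertia_diag m Iz Iphi Idelta *m jacobian r a b q.

(* Positivity of the quadratic form only; symmetry is not included. *)
Definition posdefmx (R : realType) (n : nat) (M : 'M[R]_n) : Prop :=
  forall v : 'cV[R]_n, v != 0 -> 0 < (v^T *m M *m v) 0 0.

(* Main.v *)
Require Import Defs.
From mathcomp Require Import all_boot all_order all_algebra.
From mathcomp Require Import reals trigo.
Import Order.TTheory GRing.Theory Num.Theory.
Local Open Scope ring_scope.

(** The reduced inertia matrix is a congruence [J^T *m D *m J] with [D] diagonal. Symmetry is
    inherited from [D]. For definiteness, [D] has positive entries, and [J] has trivial kernel
    whatever the angles are, because the trigonometric entries sit only in its first three rows
    ([jacobian_inj]). Hence [posdefmx_congr] transfers positivity from [D], and no explicit product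
    is computed. *)

Lemma quadratic_diag_mx (R : comPzRingType) n (d : 'rV[R]_n) (v : 'cV[R]_n) :
  (v^T *m diag_mx d *m v) 0 0 = \sum_i d 0 i * v i 0 ^+ 2.
Proof.
rewrite mul_mx_diag mxE; apply: eq_bigr => i _.
by rewrite !mxE mulrAC mulrC expr2.
Qed.

Lemma posdefmx_diag (R : realType) n (d : 'rV[R]_n) :
  (forall i, 0 < d 0 i) -> posdefmx (diag_mx d).
Proof.
move=> d_gt0 v /eqP v_neq0; rewrite quadratic_diag_mx lt_def.
have term_ge0 i : 0 <= d 0 i * v i 0 ^+ 2.
  by rewrite mulr_ge0 ?sqr_ge0 ?(ltW (d_gt0 i)).
rewrite sumr_ge0 // andbT psumr_neq0 //.
(* A sum of nonnegative terms is nonzero as soon as one term is positive, and a nonzero coordinate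
   of [v] supplies one. *)
have [/existsP[i vi]|v0] := boolP [exists i, v i 0 != 0].
  by apply/hasP; exists i; rewrite ?mem_index_enum // mulr_gt0 ?exprn_even_gt0.
case: v_neq0; apply/colP => i; rewrite mxE.
by move/existsPn: v0 => /(_ i)/negPn/eqP.
Qed.

(** The form at [v] is the form of [M] at [P *m v], which is nonzero since [P] has trivial
    kernel. *)
Lemma posdefmx_congr (R : realType) m n (M : 'M[R]_m) (P : 'M[R]_(m, n)) :
    (forall v : 'cV[R]_n, P *m v = 0 -> v = 0) ->
  posdefmx M -> posdefmx (P^T *m M *m P).
Proof.
move=> P_inj M_pos v v_neq0.
rewrite !mulmxA -trmx_mul -mulmxA.
by apply: M_pos; apply: contra_neq v_neq0; apply: P_inj.
Qed.

Lemma trmx_congr (R : comPzRingType) m n (M : 'M[R]_m) (P : 'M[R]_(m, n)) :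
  M^T = M -> (P^T *m M *m P)^T = P^T *m M *m P.
Proof. by move=> MT; rewrite !trmx_mul trmxK MT mulmxA. Qed.

(* The last three rows of the Jacobian form the matrix diag(r^-1, 1, 1). *)
Lemma jacobian_inj (R : realType) (r a b : R) (q : 'cV[R]_6) (v : 'cV[R]_3) :
  0 < r -> jacobian r a b q *m v = 0 -> v = 0.
Proof.
move=> r_gt0.
(* Cut [v] into blocks of heights 1 + (1 + 1), matching the nested [row_mx]; the sizes agree with 3
   by conversion. *)
rewrite /jacobian -[v](@vsubmxK _ 1 2 1) -[@dsubmx _ 1 2 1 v](@vsubmxK _ 1 1 1).
set x := usubmx (_ : 'cV_(1 + 2)); set y := usubmx _; set z := dsubmx _.
clearbody x y z.
rewrite (@mul_row_col _ 6 1 2 1) (@mul_row_col _ 6 1 1 1) => /colP Jv0.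
(* With 0-based indices, rows 3, 4 and 5 say that [r^-1 * x], [y] and [z] vanish. *)
have := Jv0 3; have := Jv0 4; have := Jv0 5.
rewrite !mxE !big_ord1 !mxE /= !(mul0r, mul1r, add0r, addr0) => z0 y0 /eqP.
rewrite mulf_eq0 invr_eq0 gt_eqF //= => /eqP x0.
have eq0 (w : 'cV[R]_1) : w 0 0 = 0 -> w = 0.
  by move=> w0; apply/colP => i; rewrite ord1 w0 mxE.
by rewrite (eq0 x) // (eq0 y) // (eq0 z) // !col_mx0.
Qed.

Theorem mainTheorem3 (R : realType) (m Iz Iphi Idelta r a b : R)
    (hm : 0 < m) (hIz : 0 < Iz) (hIphi : 0 < Iphi) (hIdelta : 0 < Idelta)
    (hr : 0 < r) (ha : 0 < a) (hb : 0 < b) (q : 'cV[R]_6) :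
  reduced_inertia m Iz Iphi Idelta r a b q \is symmetricmx /\
  posdefmx (reduced_inertia m Iz Iphi Idelta r a b q).
Proof.
split.
  (* [symmetricmx] is the Hermitian predicate with sign [(-1) ^+ 0] and identity conjugation; both
     are cleared here. *)
  apply/is_hermitianmxP; rewrite expr0 scale1r map_mx_id //.
  by rewrite /reduced_inertia trmx_congr // tr_diag_mx.
apply: posdefmx_congr => [v|]; first exact: jacobian_inj.
apply: posdefmx_diag => i; rewrite mxE.
by case: i => [[|[|[|[|[|[|//]]]]]] lti] /=; rewrite ?mulr_gt0.
Qed.
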